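(* Let $G$ be a group generated by a finite set $u_1,\dots,u_m$ of elements of finite orders $l_1,\dots,l_m$, respectively, and let $s=\mathrm{lcm}(l_1^{m},\dots,l_m^{m})$. Then $G$ embeds in some $4$-generated subgroup $H$ of the wreath product $G\ \mathrm{wr}\ (\mathbb{Z}_{s^2}\times\mathbb{Z}_s^2)$.
   Context: $\mathbb{Z}_n$ denotes a cyclic group of order $n$, and $\mathbb{Z}_s^2=\mathbb{Z}_s\times\mathbb{Z}_s$. A group is $k$-generated if it can be generated by $k$ elements (not necessarily distinct). For groups $A$ and $B$, let $D$ be the group of all functions $f:B\to A$ with finite support (i.e. taking non-identity values only on a finite set of points) under pointwise multiplication. $B$ acts on $D$ by $f^b(x)=f(bx)$ for $f\in D$, $b,x\in B$. The associated semidirect product $D\rtimes B$ (in which $b^{-1}fb=f^b$) is the (direct) wreath product $A\ \mathrm{wr}\ B$. *)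

(* Defs.v *)
From HB Require Import structures.
From mathcomp Require Import all_boot all_fingroup zmodp cyclic.
From mathcomp Require Import finmap.
From mathcomp Require Import boolp classical_sets.

Set Implicit Arguments.
Unset Strict Implicit.
Unset Printing Implicit Defensive.

Local Open Scope classical_set_scope.
Local Open Scope group_scope.

(* #[x] of fingroup is only available in finite groups. *)
Definition has_order (G : groupType) (x : G) (n : nat) : Prop :=
  [/\ (0 < n)%N, x ^+ n = 1 & forall k, (0 < k)%N -> x ^+ k = 1 -> (n <= k)%N].

Definition is_subgroup (G : groupType) (H : set G) : Prop :=
  group_closed [in H].

Definition generated_subgroup (G : groupType) (X : set G) : set G :=
  smallest (@is_subgroup G) X.

Definition k_generated (G : groupType) (k : nat) (H : set G) : Prop :=
  exists t : 'I_k -> G, H = generated_subgroup (range t).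

Definition embeds_in (G W : groupType) (H : set W) : Prop :=
  exists phi : {multiplicative G -> W}, injective phi /\ range phi `<=` H.

(* The additive group of residues mod n, of order n for every n > 0; 'Z_n is
   not used because 'Z_1 has two elements. The value for n = 0 is a dummy. *)
Definition cyc (n : nat) : finGroupType := 'I_n.-1.+1.

Lemma card_cyc n : (0 < n)%N -> #|{: cyc n}| = n.
Proof. by move=> n_gt0; rewrite card_ord prednK. Qed.

Lemma cyclic_cyc n : cyclic [set: cyc n]%SET.
Proof. by apply/cyclicP; exists Zp1; rewrite Zp_cycle. Qed.

Definition fsbase (B A : groupType) : Type := {fsfun B -> A with 1}.

HB.instance Definition _ (B A : groupType) := Choice.on (fsbase B A).

Section FsBase.
Variables B A : groupType.
Local Notation D := (fsbase B A).
Implicit Types (f g h : D) (b c x : B).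

Definition fsb_one : D := [fsfun with 1].
Definition fsb_mul f g : D :=
  [fsfun x in (finsupp f `|` finsupp g)%fset => f x * g x | 1].
Definition fsb_inv f : D := [fsfun x in finsupp f => (f x)^-1 | 1].

Definition fsb_act f b : D :=
  [fsfun x in [fset b^-1 * y | y in finsupp f]%fset => f (b * x) | 1].

Lemma fsb_ext f g : (forall x, f x = g x) -> f = g.
Proof. by move=> fg; apply/fsfunP. Qed.

Lemma fsb_oneE x : fsb_one x = 1.
Proof. exact: fsfun0E. Qed.

Lemma fsb_mulE f g x : fsb_mul f g x = f x * g x.
Proof.
rewrite /fsb_mul fsfunE in_fsetU.
case: ifP => // /negbT; rewrite negb_or => /andP[xf xg].
by rewrite !fsfun_dflt // mulg1.
Qed.

Lemma fsb_invE f x : fsb_inv f x = (f x)^-1.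
Proof.
rewrite /fsb_inv fsfunE.
by case: ifP => // /negbT xf; rewrite fsfun_dflt // invg1.
Qed.

Lemma fsb_actE f b x : fsb_act f b x = f (b * x).
Proof.
rewrite /fsb_act fsfunE; case: ifP => // /negbT xf.
rewrite fsfun_dflt //; apply: contra xf => bxf.
by apply/imfsetP; exists (b * x) => //=; rewrite mulKg.
Qed.

Fact fsb_mulA : associative fsb_mul.
Proof. by move=> f g h; apply: fsb_ext => x; rewrite !fsb_mulE mulgA. Qed.

Fact fsb_mul1g : left_id fsb_one fsb_mul.
Proof. by move=> f; apply: fsb_ext => x; rewrite fsb_mulE fsb_oneE mul1g. Qed.

Fact fsb_mulg1 : right_id fsb_one fsb_mul.
Proof. by move=> f; apply: fsb_ext => x; rewrite fsb_mulE fsb_oneE mulg1. Qed.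

Fact fsb_mulVg : left_inverse fsb_one fsb_inv fsb_mul.
Proof.
by move=> f; apply: fsb_ext => x; rewrite fsb_mulE fsb_invE fsb_oneE mulVg.
Qed.

Fact fsb_mulgV : right_inverse fsb_one fsb_inv fsb_mul.
Proof.
by move=> f; apply: fsb_ext => x; rewrite fsb_mulE fsb_invE fsb_oneE mulgV.
Qed.

HB.instance Definition _ := isGroup.Build D
  fsb_mulA fsb_mul1g fsb_mulg1 fsb_mulVg fsb_mulgV.

Lemma fsb_act1 f : fsb_act f 1 = f.
Proof. by apply: fsb_ext => x; rewrite fsb_actE mul1g. Qed.

Lemma fsb_actM f b c : fsb_act f (b * c) = fsb_act (fsb_act f b) c.
Proof. by apply: fsb_ext => x; rewrite !fsb_actE mulgA. Qed.

Lemma fsb_actMg f g b : fsb_act (f * g) b = fsb_act f b * fsb_act g b.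
Proof.
by apply: fsb_ext => x; rewrite fsb_actE [LHS]fsb_mulE [RHS]fsb_mulE !fsb_actE.
Qed.

End FsBase.

(* Wreath f b stands for the product f b in D ><| B; since f^b = b^-1 f b,
   (f b) (g c) = f g^(b^-1) b c. *)
Record wreath (A B : groupType) : Type :=
  Wreath { wr_base : fsbase B A; wr_top : B }.

Section WreathGroup.
Variables A B : groupType.
Local Notation W := (wreath A B).
Implicit Types (u v w : W) (f : fsbase B A) (b : B).

Definition wr_pair w : fsbase B A * B := (wr_base w, wr_top w).
Definition wr_of_pair (p : fsbase B A * B) : W := Wreath p.1 p.2.

Fact wr_pairK : cancel wr_pair wr_of_pair.
Proof. by case. Qed.

HB.instance Definition _ := Choice.copy W (can_type wr_pairK).

Definition wr_one : W := Wreath 1 1.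
Definition wr_mul u v : W :=
  Wreath (wr_base u * fsb_act (wr_base v) (wr_top u)^-1) (wr_top u * wr_top v).
Definition wr_inv u : W :=
  Wreath (fsb_act (wr_base u)^-1 (wr_top u)) (wr_top u)^-1.

Fact fsb_act1g b : fsb_act (1 : fsbase B A) b = 1.
Proof. by apply: (mulgI (fsb_act 1 b)); rewrite -fsb_actMg !mulg1. Qed.

Fact wr_mulA : associative wr_mul.
Proof.
case=> f b [g c] [h d]; rewrite /wr_mul /= fsb_actMg invgM fsb_actM.
by rewrite !mulgA.
Qed.

Fact wr_mul1g : left_id wr_one wr_mul.
Proof. by case=> f b; rewrite /wr_mul /= invg1 fsb_act1 !mul1g. Qed.

Fact wr_mulg1 : right_id wr_one wr_mul.
Proof. by case=> f b; rewrite /wr_mul /= fsb_act1g !mulg1. Qed.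

Fact wr_mulVg : left_inverse wr_one wr_inv wr_mul.
Proof.
by case=> f b; rewrite /wr_mul /= invgK -fsb_actMg !mulVg fsb_act1g.
Qed.

Fact wr_mulgV : right_inverse wr_one wr_inv wr_mul.
Proof.
by case=> f b; rewrite /wr_mul /= -fsb_actM !mulgV fsb_act1 mulgV.
Qed.

HB.instance Definition _ := isGroup.Build W
  wr_mulA wr_mul1g wr_mulg1 wr_mulVg wr_mulgV.

Lemma wr_conjE f b :
  (Wreath 1 b : W)^-1 * Wreath f 1 * Wreath 1 b = Wreath (fsb_act f b) 1.
Proof.
have VE : (Wreath 1 b : W)^-1 = Wreath 1 b^-1.
  by congr Wreath; rewrite invg1 fsb_act1g.
rewrite VE; congr Wreath; rewrite /= ?mulg1 ?mulVg //.
by rewrite invgK fsb_act1g mul1g mulg1.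
Qed.

End WreathGroup.

(* Main.v *)
Require Import Defs.
From HB Require Import structures.
From mathcomp Require Import all_boot all_fingroup zmodp cyclic.
From mathcomp Require Import finmap.
From mathcomp Require Import boolp classical_sets.

(** The subgroup H is generated by the three standard generators of the top
group and by a single base function f.  Write a point of the top group as
(z, x, y).  The coordinate z keeps the generators of G apart: on the slice
z = j all the values of f are powers of u_j, so every computation with
translates of f along x and y takes place in the cyclic groups <u_j>.  The
coordinates x and y are used to separate the generators.  With
  M_j = \prod_(k < j) l_k   and   N_j = \prod_(k > j) l_k
put
  f (j, x, y) = u_j ^ (floor (x / M_j) * floor (y / N_j)).
Modulo l_j, the function floor (x / M_j) is a digit of x in the mixed radix
system with radices l_0, l_1, ...; it has period M_j * l_j, and N_j * l_j is
the period of the digit of y in the system with the radices in the opposite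
order.  Both periods divide \prod_k l_k, which divides s, so that f is well
defined on residues mod s.

Consider the mixed second difference of f with step M_i along x and N_i along
y.  On the slice j < i, the period M_j * l_j divides M_i and the difference in
x vanishes; on the slice j > i, the period N_j * l_j divides N_i and the
difference in y vanishes; on the slice j = i, both digits grow by one mod l_i
and the second difference of the exponent is 1 (lemma
[mixed_difference_slice]).  So this difference, which belongs to H, takes the
value u_i on the slice z = i and 1 elsewhere.  Its translates along z have
disjoint supports, and their product is the constant function u_i
([const_generator_in]).  Hence H contains all constant functions, and these
form a copy of G.

The slices need i < s ^ 2.  If u_i <> 1 then l_i >= 2, hence
i < m < 2 ^ m <= l_i ^ m <= s; and if u_i = 1 there is nothing to obtain. *)

Set Implicit Arguments.
Unset Strict Implicit.
Unset Printing Implicit Defensive.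

Local Open Scope classical_set_scope.
Local Open Scope group_scope.

(** * Subgroups given as sets *)

Lemma is_subgroupP (G : groupType) (H : set G) :
  is_subgroup H <-> H 1 /\ (forall x y, H x -> H y -> H (x * y^-1)).
Proof.
split=> -[H1 HV]; split; try by move: H1; rewrite !inE.
- by move=> x y Hx Hy; have := HV x y; rewrite !inE; apply.
- by move=> x y; rewrite !inE; apply: HV.
Qed.

Section Subgroup.
Variables (G : groupType) (H : set G).
Hypothesis sgH : is_subgroup H.

Lemma subgroup1 : H 1. Proof. by have /is_subgroupP[] := sgH. Qed.

Lemma subgroup_div x y : H x -> H y -> H (x * y^-1).
Proof. by have /is_subgroupP[_] := sgH; apply. Qed.

Lemma subgroupV x : H x -> H x^-1.
Proof. by rewrite -[x^-1]mul1g; apply/subgroup_div/subgroup1. Qed.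

Lemma subgroupM x y : H x -> H y -> H (x * y).
Proof. by move=> Hx /subgroupV; rewrite -{2}[y]invgK; apply: subgroup_div. Qed.

Lemma subgroupX x n : H x -> H (x ^+ n).
Proof.
move=> Hx; elim: n => [|n IHn]; first exact: subgroup1.
by rewrite expgS; apply: subgroupM.
Qed.

End Subgroup.

Lemma generated_is_subgroup (G : groupType) (X : set G) :
  is_subgroup (generated_subgroup X).
Proof.
apply/is_subgroupP; split=> [M [sgM _]|x y Xx Xy M XM]; first exact: subgroup1.
by apply: subgroup_div; [case: XM|apply: Xx|apply: Xy].
Qed.

Lemma preimage_is_subgroup (G K : groupType) (phi : G -> K) (H : set K) :
  {morph phi : x y / x * y} -> is_subgroup H -> is_subgroup (phi @^-1` H).
Proof.
move=> phiM sgH; have phi1 : phi 1 = 1.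
  by apply: (mulgI (phi 1)); rewrite -phiM !mulg1.
apply/is_subgroupP; rewrite /preimage /= phi1; split=> [|x y Hx Hy].
  exact: subgroup1.
have -> : phi (x * y^-1) = phi x * (phi y)^-1.
  by apply: (canRL (mulgK _)); rewrite -phiM mulgKV.
exact: subgroup_div.
Qed.

(** * Mixed radix digits *)

Lemma eq_expg_mod (G : groupType) (x : G) (l a b : nat) :
  x ^+ l = 1 -> a = b %[mod l] -> x ^+ a = x ^+ b.
Proof.
move=> xl1; have xmod n : x ^+ (n %% l) = x ^+ n.
  by rewrite [in RHS](divn_eq n l) expgnDr mulnC expgnA xl1 expg1n mul1g.
by rewrite -[x ^+ a]xmod -[x ^+ b]xmod => ->.
Qed.

Section Digit.
Variables (l M : nat).

Lemma digit_modn s n : (l * M %| s)%N -> (n %% s) %/ M = n %/ M %[mod l].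
Proof. by move=> lM_s; rewrite !modn_divl modn_dvdm. Qed.

Lemma digit_period t n : (l * M %| t)%N -> (t + n) %/ M = n %/ M %[mod l].
Proof.
by move=> lM_t; rewrite !modn_divl -modnDml (eqP lM_t) add0n.
Qed.

End Digit.

(** The form in which all divisibilities between place values are used: the
period of digit j, which is l_j times the product of the l_k with k before j,
divides every product over a larger initial segment that contains j. *)
Lemma dvdn_mul_prod (I : finType) (F : I -> nat) (P Q : pred I) (j : I) :
    ~~ P j -> Q j -> (forall k, P k -> Q k) ->
  (F j * \prod_(k | P k) F k %| \prod_(k | Q k) F k)%N.
Proof.
move=> nPj Qj PQ; rewrite [X in (_ %| X)%N](bigD1 j) //= dvdn_mul //.
rewrite [X in (_ %| X)%N](bigID P) /= dvdn_mulr //.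
rewrite [X in (_ %| X)%N](_ : _ = (\prod_(k | P k) F k)%N) //.
apply: eq_bigl => k; case Pk: (P k); rewrite ?andbF // PQ //=.
by rewrite andbT; apply: contraNneq nPj => <-.
Qed.

(** Raised to the power m, both sides become products of m factors, which
can be compared one by one. *)
Lemma prod_dvd_of_exp_dvd (m : nat) (l : 'I_m -> nat) (s : nat) :
  (forall i, l i ^ m %| s)%N -> (\prod_(i < m) l i %| s)%N.
Proof.
case: m => [|m] in l * => lX_s; first by rewrite big_ord0 dvd1n.
rewrite -(@dvdn_pexp2r _ _ m.+1) //.
rewrite (big_morph (expn^~ m.+1) (fun a b => expnMn a b m.+1) (exp1n _)).
have -> : (s ^ m.+1 = \prod_(i < m.+1) s)%N by rewrite prod_nat_const card_ord.
by elim/big_ind2: _ => // *; apply: dvdn_mul.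
Qed.

(** The mixed second difference of g, in multiplicative notation. *)
Definition mixed_quotient (G : groupType) (g : nat -> nat -> G) a a' b b' : G :=
  g a' b' * (g a b')^-1 * (g a' b * (g a b)^-1)^-1.

Lemma subgroup_mixed_quotient (G : groupType) (H : set G) g a a' b b' :
    is_subgroup H -> (forall c d, H (g c d)) ->
  H (mixed_quotient g a a' b b').
Proof. by move=> sgH Hg; do !apply: (subgroup_div sgH). Qed.

(** Additively this is (A' - A)(B' - B) = A'B' - AB' - (A'B - AB): the mixed
second difference of a product of functions of separate variables is the
product of the two first differences. *)
Lemma mixed_difference (G : groupType) (x : G) (l A A' B B' : nat) :
    x ^+ l = 1 ->
  [/\ A' = A %[mod l] ->
        mixed_quotient (fun a b => x ^+ (a * b)) A A' B B' = 1,
      B' = B %[mod l] ->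
        mixed_quotient (fun a b => x ^+ (a * b)) A A' B B' = 1
    & A' = A.+1 -> B' = B.+1 ->
        mixed_quotient (fun a b => x ^+ (a * b)) A A' B B' = x].
Proof.
rewrite /mixed_quotient => xl1; split=> [eqA | eqB | -> ->].
- have xA C : x ^+ (A' * C) = x ^+ (A * C).
    by apply: eq_expg_mod xl1 _; rewrite -modnMml eqA modnMml.
  by rewrite !xA !mulgV.
- have xB C : x ^+ (C * B') = x ^+ (C * B).
    by apply: eq_expg_mod xl1 _; rewrite -modnMmr eqB modnMmr.
  by rewrite !xB mulgV.
- by rewrite !mulSn !expgnDr !mulgK expgS mulgK.
Qed.

(** * Elements of the wreath product *)

Section FullFunction.
Variables (B : finGroupType) (A : groupType).

Definition fsb_of (g : B -> A) : fsbase B A :=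
  [fsfun x in [fset y | y in B]%fset => g x | 1].

Lemma fsb_ofE g x : fsb_of g x = g x.
Proof. by rewrite fsfunE in_fset. Qed.

Definition const_wr (a : A) : wreath A B := Wreath (fsb_of (fun=> a)) 1.

Lemma const_wrM : {morph const_wr : a b / a * b}.
Proof.
move=> a b; congr Wreath; last by rewrite /= mul1g.
by rewrite /= invg1 fsb_act1; apply: fsb_ext => x; rewrite fsb_mulE !fsb_ofE.
Qed.

HB.instance Definition _ := isMultiplicative.Build A (wreath A B)
  const_wr const_wrM.

Lemma const_wr_inj : injective const_wr.
Proof.
move=> a b [/(congr1 (fun f : fsbase B A => f 1))].
by rewrite !fsb_ofE.
Qed.

End FullFunction.

Section WreathSubgroup.
Variables (A B : groupType) (H : set (wreath A B)).
Hypothesis sgH : is_subgroup H.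

Lemma base_morphM :
  {morph (fun f : fsbase B A => Wreath f 1 : wreath A B) : f g / f * g}.
Proof.
by move=> f g; congr Wreath; rewrite /= ?mul1g // invg1 fsb_act1.
Qed.

Lemma top_morphM :
  {morph (fun b : B => Wreath 1 b : wreath A B) : b c / b * c}.
Proof. by move=> b c; congr Wreath; rewrite /= fsb_act1g mul1g. Qed.

Lemma base_act_in f b : H (Wreath f 1) -> H (Wreath 1 b) ->
  H (Wreath (fsb_act f b) 1).
Proof.
move=> Hf Hb; rewrite -wr_conjE; apply: subgroupM => //.
by apply: subgroupM => //; apply: subgroupV.
Qed.

End WreathSubgroup.

(** * Separating the generators *)

Section Construction.
Variables (G : groupType) (m : nat) (u : 'I_m -> G) (l : 'I_m -> nat) (s : nat).
Hypothesis u_exp : forall i, u i ^+ l i = 1.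
Hypothesis l_gt0 : forall i, (0 < l i)%N.
Hypothesis s_gt0 : (0 < s)%N.
Hypothesis exp_dvd_s : forall i, (l i ^ m %| s)%N.

Local Notation B := (cyc (s ^ 2) * (cyc s * cyc s))%type.

(** The place values M_i and N_i of digit i, in the mixed radix systems with
radices l_0, l_1, ... and ..., l_1, l_0 respectively. *)
Definition lower_place (i : 'I_m) : nat := \prod_(k < m | (k < i)%N) l k.
Definition upper_place (i : 'I_m) : nat := \prod_(k < m | (i < k)%N) l k.

Lemma lower_period_s i : (l i * lower_place i %| s)%N.
Proof.
by apply: dvdn_trans (prod_dvd_of_exp_dvd exp_dvd_s); apply: dvdn_mul_prod;
rewrite ?ltnn.
Qed.

Lemma upper_period_s i : (l i * upper_place i %| s)%N.
Proof.
by apply: dvdn_trans (prod_dvd_of_exp_dvd exp_dvd_s); apply: dvdn_mul_prod;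
rewrite ?ltnn.
Qed.

Lemma lower_period_place (i j : 'I_m) : (j < i)%N ->
  (l j * lower_place j %| lower_place i)%N.
Proof.
by move=> ji; apply: dvdn_mul_prod => [||k /ltn_trans]; rewrite ?ltnn //; apply.
Qed.

Lemma upper_period_place (i j : 'I_m) : (i < j)%N ->
  (l j * upper_place j %| upper_place i)%N.
Proof.
by move=> ij; apply: dvdn_mul_prod => [||k]; rewrite ?ltnn //; apply: ltn_trans.
Qed.

Definition slice_value (j : 'I_m) (x y : nat) : G :=
  u j ^+ ((x %/ lower_place j) * (y %/ upper_place j)).

(** This is where s comes in: both digits of index j have periods dividing s,
so that a slice of the seed can be translated without attention to
wrap-around. *)
Lemma slice_value_modn j x y :
  slice_value j (x %% s) (y %% s) = slice_value j x y.
Proof.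
apply: eq_expg_mod (u_exp j) _.
rewrite -modnMml (digit_modn _ (lower_period_s j)) modnMml.
by rewrite -modnMmr (digit_modn _ (upper_period_s j)) modnMmr.
Qed.

(** The two radix systems run in opposite directions in order that each j <> i
be annihilated by one of the two steps: j < i by the step in x, because the
place value of a higher digit is a multiple of the period of a lower one, and
j > i by the step in y, for the same reason in the reversed system. *)
Lemma mixed_difference_slice i j x y :
  mixed_quotient (fun a b => slice_value j (a + x) (b + y))
    0 (lower_place i) 0 (upper_place i) = if j == i then u i else 1.
Proof.
have [eqA eqB unit] := mixed_difference
  ((0 + x) %/ lower_place j) ((lower_place i + x) %/ lower_place j)
  ((0 + y) %/ upper_place j) ((upper_place i + y) %/ upper_place j) (u_exp j).
case: (ltngtP j i) => [ji | ij | /val_inj eq_ji].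
- rewrite -val_eqE ltn_eqF //; apply: eqA.
  exact/digit_period/lower_period_place.
- rewrite -val_eqE gtn_eqF //; apply: eqB.
  exact/digit_period/upper_period_place.
- rewrite eq_ji eqxx in unit *; apply: unit; rewrite divnDl // divnn.
    by rewrite prodn_gt0.
  by rewrite prodn_gt0.
Qed.

Definition seed : fsbase B G := fsb_of (fun p : B =>
  if insub (p.1 : nat) is Some j then slice_value j p.2.1 p.2.2 else 1).

(** Since H contains the translates of the seed by the whole top group, it
contains their mixed second differences.  The residue inZp 0 is the identity,
so that the steps are taken from the untranslated seed. *)
Definition isolated (i : 'I_m) : fsbase B G :=
  mixed_quotient (fun a b => fsb_act seed (1, (inZp a, inZp b)))
    0 (lower_place i) 0 (upper_place i).

(** On a slice all values of the seed are powers of one generator, so the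
mixed difference can be computed slice by slice in commutative groups; on the
slices z >= m the seed is trivial. *)
Lemma isolatedE i (p : B) :
  isolated i p = if p.1 == i :> nat then u i else 1.
Proof.
case: p => z [x y]; rewrite /isolated /mixed_quotient.
have VE (g : fsbase B G) p : g^-1 p = (g p)^-1 := fsb_invE g p.
have ME (g h : fsbase B G) p : (g * h) p = g p * h p := fsb_mulE g h p.
have actE a b : fsb_act seed (1, (inZp a, inZp b)) (z, (x, y)) =
    if insub (z : nat) is Some j then slice_value j (a + x) (b + y) else 1.
  rewrite fsb_actE fsb_ofE /= add0n [z %% _]modn_small //; case: insub => // j.
  rewrite !modnDml -[RHS]slice_value_modn.
  by congr slice_value; rewrite [X in (_ %% X)%N = _]prednK.
rewrite !(ME, VE) !actE /=; case: insubP => [j _ <- | z_ge_m].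
  exact: mixed_difference_slice.
rewrite !(mulg1, mulgV); case: eqP => // zi.
by rewrite zi ltn_ord in z_ge_m.
Qed.

(** The factors have disjoint supports, hence the product can be read off
pointwise: at a point of first coordinate z only the translation by i - z
contributes. *)
Lemma prod_isolated (i : 'I_m) : (i < s ^ 2)%N ->
  \prod_(k : cyc (s ^ 2)) fsb_act (isolated i) (k, (1, 1)) = fsb_of (fun=> u i).
Proof.
move=> i_lt; apply: fsb_ext => -[z [x y]]; rewrite fsb_ofE.
rewrite (big_morph (fun g : fsbase B G => g (z, (x, y)))
  (fun g h => fsb_mulE g h _) (fsb_oneE _ _)).
pose z_i : cyc (s ^ 2) := inZp i.
have z_iE : z_i = i :> nat by rewrite /= modn_small // prednK // expn_gt0 s_gt0.
have actE k : fsb_act (isolated i) (k, (1, 1)) (z, (x, y)) =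
    if k * z == z_i then u i else 1.
  by rewrite fsb_actE isolatedE -z_iE.
rewrite (big_only1 (z_i * z^-1)) // => [|k k_neq _]; rewrite actE.
  by rewrite mulgKV eqxx.
by case: eqP => // kz; rewrite -kz mulgK eqxx in k_neq.
Qed.

(** * The four generators *)

Definition four_generators (t : 'I_4) : wreath G B :=
  nth 1 [:: Wreath seed 1; Wreath 1 (Zp1, (1, 1)); Wreath 1 (1, (Zp1, 1));
            Wreath 1 (1, (1, Zp1))] t.

Definition four_generated : set (wreath G B) :=
  generated_subgroup (range four_generators).

Let sgH : is_subgroup four_generated := generated_is_subgroup _.

Lemma seed_in : four_generated (Wreath seed 1).
Proof. by apply: sub_gen_smallest; exists 0%R. Qed.

(** The top group is reached one cyclic factor at a time, through the
inclusion phi of the factor generated by Zp1. *)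
Lemma top_factor_in (n : nat) (phi : cyc n -> B) (t : 'I_4) :
    {morph phi : x y / x * y} -> four_generators t = Wreath 1 (phi Zp1) ->
  forall x, four_generated (Wreath 1 (phi x)).
Proof.
move=> phiM genE x; rewrite -[x]Zp1_expgz.
have sgT := preimage_is_subgroup (@top_morphM G B) sgH.
apply: (subgroupX (preimage_is_subgroup phiM sgT)).
by apply: sub_gen_smallest; exists t.
Qed.

Lemma top_in (b : B) : four_generated (Wreath 1 b).
Proof.
have sgT := preimage_is_subgroup (@top_morphM G B) sgH.
case: b => z [x y].
have -> : (z, (x, y)) = (z, (1, 1)) * (1, (x, 1)) * (1, (1, y)) :> B.
  by congr (_, (_, _)); rewrite /= ?mul1g ?mulg1.
apply: (subgroupM sgT); first apply: (subgroupM sgT).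
- apply: (@top_factor_in _ (fun z => (z, (1, 1)))
    (Ordinal (isT : (1 < 4)%N))) => // ? ?.
  by congr (_, (_, _)); rewrite /= mul1g.
- apply: (@top_factor_in _ (fun x => (1, (x, 1)))
    (Ordinal (isT : (2 < 4)%N))) => // ? ?.
  by congr (_, (_, _)); rewrite /= mul1g.
- apply: (@top_factor_in _ (fun y => (1, (1, y)))
    (Ordinal (isT : (3 < 4)%N))) => // ? ?.
  by congr (_, (_, _)); rewrite /= mul1g.
Qed.

Lemma isolated_in i : four_generated (Wreath (isolated i) 1).
Proof.
have sgD := preimage_is_subgroup (@base_morphM G B) sgH.
refine (subgroup_mixed_quotient _ _ _ _ sgD _) => a b.
by apply: (base_act_in sgH); [apply: seed_in | apply: top_in].
Qed.

Lemma const_generator_in i : four_generated (const_wr B (u i)).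
Proof.
have sgD := preimage_is_subgroup (@base_morphM G B) sgH.
have [-> | u_neq1] := eqVneq (u i) 1.
  exact: subgroup1 (preimage_is_subgroup (@const_wrM B G) sgH).
have l_gt1 : (1 < l i)%N.
  rewrite ltn_neqAle l_gt0 andbT; apply: contra_neq u_neq1 => l1.
  by rewrite -(u_exp i) -l1.
have i_lt : (i < s ^ 2)%N.
  (* i < m < 2 ^ m <= l i ^ m <= s <= s ^ 2 *)
  apply: leq_trans (leq_pexp2l s_gt0 (isT : 0 < 2)%N); rewrite expn1.
  apply: leq_trans (dvdn_leq s_gt0 (exp_dvd_s i)).
  have m_gt0 : (0 < m)%N := leq_ltn_trans (leq0n i) (ltn_ord i).
  apply: (@leq_trans (2 ^ m)); last by rewrite leq_exp2r.
  exact: ltn_trans (ltn_ord i) (ltn_expl m _).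
rewrite /const_wr -(prod_isolated i_lt).
apply: (big_ind (fun f => four_generated (Wreath f 1))) => [|f g|k _].
- exact: (subgroup1 sgD).
- exact: (subgroupM sgD (x := f) (y := g)).
- by apply: (base_act_in sgH); [apply: isolated_in | apply: top_in].
Qed.

End Construction.

Theorem theorem5 (G : groupType) (m : nat) (u : 'I_m -> G) (l : 'I_m -> nat)
    (s : nat)
    (u_order : forall i, has_order (u i) (l i))
    (u_gen : generated_subgroup (range u) = setT)
    (s_def : s = (\big[lcmn/1]_(i < m) (l i ^ m))%N) :
  exists H : set (wreath G (cyc (s ^ 2) * (cyc s * cyc s))%type),
    [/\ is_subgroup H, k_generated 4 H & embeds_in G H].
Proof.
have l_gt0 i : (0 < l i)%N by case: (u_order i).
have u_exp i : u i ^+ l i = 1 by case: (u_order i).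
have exp_dvd_s i : (l i ^ m %| s)%N by rewrite s_def; apply: (biglcmn_sup i).
have s_gt0 : (0 < s)%N.
  rewrite s_def; elim/big_ind: _ => // [a b a_gt0 b_gt0 | i _].
    by rewrite lcmn_gt0 a_gt0.
  by rewrite expn_gt0 l_gt0.
pose B : finGroupType := (cyc (s ^ 2) * (cyc s * cyc s))%type.
pose H : set (wreath G B) := four_generated u l (s := s).
have sgH : is_subgroup H := generated_is_subgroup _.
exists H; split=> //; first by exists (four_generators u l s).
exists (const_wr B (A := G)); split; first exact: const_wr_inj.
have const_in : generated_subgroup (range u) `<=` const_wr B (A := G) @^-1` H.
  apply: smallest_sub; first exact: preimage_is_subgroup (@const_wrM B G) sgH.
  by move=> _ [i _ <-]; apply: const_generator_in.
by move=> _ [x _ <-]; apply: const_in; rewrite u_gen.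
Qed.
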